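(* Let $m,n\ge 4$, let $U$ be an $m\times m$ complex unitary matrix such that $\sqrt{m}\,U$ is a complex Hadamard matrix, and let $V$ be an $n\times n$ complex unitary matrix such that $\sqrt{n}\,V$ is a complex Hadamard matrix. Then $$\delta_2(U\otimes V)=\frac{mn-3}{2mn}+2\left(\delta_2(U)-\frac{m-3}{2m}\right)\left(\delta_2(V)-\frac{n-3}{2n}\right)+\frac{1}{n}\left(\delta_2(U)-\frac{m-3}{2m}\right)+\frac{1}{m}\left(\delta_2(V)-\frac{n-3}{2n}\right).$$
   Context: Here $U\otimes V$ is the Kronecker (tensor) product, an $mn\times mn$ unitary matrix. A complex Hadamard matrix of order $k$ is a $k\times k$ complex matrix $H=(h_{ij})$ with $|h_{ij}|=1$ for all $i,j$ and $HH^*=kI_k$. For a $k\times k$ unitary matrix $W$ (with $k\ge 2$), the second uniform-minor discrepancy is $$\delta_2(W)=\sum_{\substack{I,J\subset\{1,\dots,k\}\\|I|=|J|=2}}\left(|\det W[I,J]|^2-\binom{k}{2}^{-1}\right)^2,$$ where $W[I,J]$ is the submatrix of $W$ with row set $I$ and column set $J$. *)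

(* Defs.v *)
From mathcomp Require Import all_boot all_order all_algebra.
From mathcomp Require Import complex mxtens reals.

Set Implicit Arguments.
Unset Strict Implicit.
Unset Printing Implicit Defensive.

Import Order.TTheory GRing.Theory Num.Theory.
Local Open Scope ring_scope.
Local Open Scope complex_scope.
Local Open Scope sesquilinear_scope.

Definition complex_hadamard (R : realType) (k : nat) (H : 'M[R[i]]_k) : Prop :=
  (forall i j : 'I_k, `|H i j| = 1) /\ H *m H^t* = (k%:R)%:M.

Definition rsubset (k r : nat) := {I : {set 'I_k} | #|I| == r}.

Definition rsubset_nth (k r : nat) (I : rsubset k r) (a : 'I_r) : 'I_k :=
  enum_val (cast_ord (esym (eqP (valP I))) a).

Definition submatrix (T : Type) (k r : nat) (W : 'M[T]_k) (I J : rsubset k r) :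
    'M[T]_r :=
  mxsub (rsubset_nth I) (rsubset_nth J) W.

(* [normc] is the [R]-valued modulus, whereas [`|_|] lands in [R[i]]; with the
   former the discrepancy is a real number. *)
Definition delta2 (R : realType) (k : nat) (W : 'M[R[i]]_k) : R :=
  \sum_(I : rsubset k 2) \sum_(J : rsubset k 2)
    (ComplexField.Normc.normc (\det (submatrix W I J)) ^+ 2
       - ('C(k, 2))%:R^-1) ^+ 2.

(* Main.v *)
Require Import Defs.
From mathcomp Require Import all_boot all_order all_algebra.
From mathcomp Require Import complex mxtens reals.
From mathcomp Require Import ring.

(** Put [u = 1/k] and let [W] be a unitary matrix of order [k] all of whose
    entries have squared modulus [u].  For rows [i, j] and columns [a, b] the
    minor [D] satisfies [|D|^2 = 2 u^2 - z - z'], where [z] is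
    [W i a * W j b * conj (W i b * W j a)], a number of modulus [u^2], and [z']
    is its conjugate.  Hence, for every constant [c], [|D|^4 - 2 c |D|^2] is a
    constant plus a multiple of [z + z'] plus [z^2 + z'^2].  Summed over all
    quadruples [(i, j, a, b)],
     - [z] gives the trace of the square of [W W*], which is [k] by unitarity;
     - [z^2] is the same expression for the matrix [S] of squared entries, so
       it gives the trace [q] of the square of [S S*], the only quantity that
       depends on [W].
    This yields [delta2 W = 1/2 - 2/k + q/2] ([delta2_flat]), that is,
    [q = 2 (delta2 W - (k - 3)/(2k)) + 1/k].

    Squaring entries, adjoints, products and traces are all compatible with the
    Kronecker product, so [q] is multiplicative ([phase_energy_tens]).  As a
    Kronecker product of flat unitary matrices is again flat and unitary,
    [q (U *t V) = q U * q V] rewritten in terms of [delta2] is the identity. *)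

Set Implicit Arguments.
Unset Strict Implicit.
Unset Printing Implicit Defensive.

Import Order.TTheory GRing.Theory Num.Theory.
Local Open Scope ring_scope.
Local Open Scope complex_scope.

(** * Pairs of indices and two-element subsets *)

Lemma rsubset_nth_inj (k r : nat) (I : rsubset k r) :
  injective (rsubset_nth I).
Proof. by move=> a b /enum_val_inj /cast_ord_inj. Qed.

Lemma rsubset2E (k : nat) (I : rsubset k 2) :
  val I = [set rsubset_nth I 0; rsubset_nth I 1].
Proof.
apply/eqP; rewrite eq_sym eqEcard subUset !sub1set !enum_valP /=.
by rewrite (eqP (valP I)) cards2 (inj_eq (@rsubset_nth_inj k 2 I)).
Qed.

(** Each two-element subset is the image of exactly two off-diagonal pairs.
    Since [G] vanishes on the diagonal, sums over subsets become unrestricted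
    double sums, which can be read as matrix products. *)
Lemma sum_ordered_pairs (A : nmodType) (k : nat) (G : 'I_k -> 'I_k -> A) :
    (forall x y, G x y = G y x) -> (forall x, G x x = 0) ->
  \sum_x \sum_y G x y =
    (\sum_(I : rsubset k 2) G (rsubset_nth I 0) (rsubset_nth I 1)) *+ 2.
Proof.
move=> Gsym Gdiag; rewrite pair_big /= (bigID (fun p => p.1 != p.2)) /=.
rewrite [X in _ + X]big1 ?addr0; last first.
  by move=> [x y] /=; rewrite negbK => /eqP ->.
transitivity (\sum_(p : 'I_k * 'I_k | p.1 != p.2)
    \sum_(I : rsubset k 2 | val I == [set p.1; p.2]) G p.1 p.2).
  apply: eq_bigr => -[x y] /= xy.
  have c2 : #|[set x; y]| == 2 by rewrite cards2 xy.
  by rewrite (big_pred1 (exist _ [set x; y] c2 : rsubset k 2)).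
rewrite (exchange_big_dep predT) //= -sumrMnl; apply: eq_bigr => I _.
set x := rsubset_nth I 0; set y := rsubset_nth I 1.
have xy : x != y by rewrite (inj_eq (@rsubset_nth_inj k 2 I)).
have Ixy : sval I = [set x; y] by exact: rsubset2E.
rewrite (bigD1 (x, y)) /= ?xy ?Ixy ?eqxx // (bigD1 (y, x)) /=; last first.
  by rewrite eq_sym xy setUC eqxx xpair_eqE negb_and eq_sym xy.
rewrite big1 ?addr0 ?[G y x]Gsym ?mulr2n // => -[a b] /=.
case/andP=> /andP[/andP[ab /eqP E]].
have : a \in [set x; y] by rewrite E set21.
have : b \in [set x; y] by rewrite E set22.
rewrite !inE !xpair_eqE => /orP[]/eqP bE /orP[]/eqP aE;
  by move: ab; rewrite aE bE ?eqxx ?andbF.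
Qed.

Lemma card_rsubset (k r : nat) : #|{: rsubset k r}| = 'C(k, r).
Proof. by rewrite card_sig -[k in RHS]card_ord -card_draws cardsE. Qed.

(** * Determinants, moduli and traces *)

Lemma det2E (A : comPzRingType) (M : 'M[A]_2) :
  \det M = M 0 0 * M 1 1 - M 0 1 * M 1 0.
Proof.
rewrite (expand_det_row _ 0) !big_ord_recl big_ord0 addr0 /cofactor !det_mx11.
rewrite !mxE /= expr0 expr1 mul1r mulN1r mulrN.
by congr (_ * M _ _ - M _ _ * M _ _); apply: val_inj.
Qed.

Lemma normc_sqrE (R : rcfType) (z : R[i]) :
  (ComplexField.Normc.normc z ^+ 2)%:C = z * Num.conj z.
Proof. by rewrite -normCK rmorphXn. Qed.

Lemma mxtrace_tens (A : comPzRingType) (m n : nat) (M : 'M[A]_m) (N : 'M[A]_n) :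
  \tr (M *t N) = \tr M * \tr N.
Proof. by rewrite mulr_sum; apply: eq_bigr => i _; rewrite mxE. Qed.

(** * The phase sums *)

Definition gram (C : numClosedFieldType) (k l : nat) (X : 'M[C]_(k, l)) : 'M[C]_k :=
  X *m (X ^t*)%sesqui.

Lemma gram_tens (C : numClosedFieldType) (m n : nat) (X : 'M[C]_m) (Y : 'M[C]_n) :
  gram (X *t Y) = gram X *t gram Y.
Proof. by rewrite /gram trmx_tens map_mxT tensmx_mul. Qed.

(** The cross term in the squared modulus of the minor on rows [i, j] and
    columns [a, b]; exchanging [a] and [b] conjugates it. *)
Definition phase (C : numClosedFieldType) (k l : nat) (X : 'M[C]_(k, l))
    (i j : 'I_k) (a b : 'I_l) : C :=
  X i a * X j b * (X i b * X j a)^*.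

(** For fixed [i] and [j] the sum over [a] and [b] factors as
    [gram X i j * gram X j i]. *)
Lemma sum_phase (C : numClosedFieldType) (k l : nat) (X : 'M[C]_(k, l)) :
  \sum_i \sum_j \sum_a \sum_b phase X i j a b = \tr (gram X *m gram X).
Proof.
apply: eq_bigr => i _; rewrite mxE; apply: eq_bigr => j _.
rewrite !mxE big_distrlr /=; apply: eq_bigr => a _; apply: eq_bigr => b _.
by rewrite !mxE /phase rmorphM /=; ring.
Qed.

Definition sqr_mx (C : numClosedFieldType) (k l : nat) (X : 'M[C]_(k, l)) :
    'M[C]_(k, l) :=
  map_mx (fun z => z ^+ 2) X.

Definition phase_energy (C : numClosedFieldType) (k : nat) (W : 'M[C]_k) : C :=
  \tr (gram (sqr_mx W) *m gram (sqr_mx W)).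

(** Multiplicativity of this invariant is what makes the discrepancy of a
    Kronecker product computable from those of its factors. *)
Lemma phase_energy_tens (C : numClosedFieldType) (m n : nat)
    (U : 'M[C]_m) (V : 'M[C]_n) :
  phase_energy (U *t V) = phase_energy U * phase_energy V.
Proof.
rewrite /phase_energy.
have -> : sqr_mx (U *t V) = sqr_mx U *t sqr_mx V.
  by apply/matrixP => i j; rewrite !mxE exprMn.
by rewrite gram_tens tensmx_mul mxtrace_tens.
Qed.

(** * The discrepancy of a flat unitary matrix *)

Definition flat (C : numClosedFieldType) (k : nat) (W : 'M[C]_k) :=
  forall i a, W i a * (W i a)^* = k%:R^-1.

(** The term [c ^+ 2] of the expanded square [(|D|^2 - c)^2] is left out so that
    the summand vanishes with [D], in particular when [i = j] or [a = b]: the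
    unrestricted sum is then four times the sum over pairs of subsets. *)
Lemma sum_minor (C : numClosedFieldType) (k : nat) (W : 'M[C]_k) (c : C) :
    (0 < k)%N -> W \is unitarymx -> flat W ->
  let D i j a b := W i a * W j b - W i b * W j a in
  \sum_i \sum_j \sum_a \sum_b
     ((D i j a b * (D i j a b)^*) ^+ 2 - 2 * c * (D i j a b * (D i j a b)^*))
  = 6 - 4 * c * k%:R ^+ 2 + (2 * c - 4 / k%:R ^+ 2) * (2 * k%:R)
    + 2 * phase_energy W.
Proof.
move=> k0 /unitarymxP Wunit Wflat D.
have kC : k%:R != 0 :> C by rewrite pnatr_eq0 -lt0n.
pose u : C := k%:R^-1.
transitivity (\sum_i \sum_j \sum_a \sum_b
    ((6 * u ^+ 4 - 4 * c * u ^+ 2)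
     + (2 * c - 4 * u ^+ 2) * (phase W i j a b + phase W i j b a)
     + (phase (sqr_mx W) i j a b + phase (sqr_mx W) i j b a))).
  apply: eq_bigr => i _; apply: eq_bigr => j _.
  apply: eq_bigr => a _; apply: eq_bigr => b _.
  pose z := phase W i j a b; pose z' := phase W i j b a.
  have DD : D i j a b * (D i j a b)^* = 2 * u ^+ 2 - (z + z').
    rewrite /D /z /z' /phase rmorphB !rmorphM /=.
    transitivity ((W i a * (W i a)^*) * (W j b * (W j b)^*)
      + (W i b * (W i b)^*) * (W j a * (W j a)^*) - (z + z')).
      by rewrite /z /z' /phase !rmorphM /=; ring.
    by rewrite !Wflat /z /z' /phase !rmorphM /= -/u; ring.
  have zz : z * z' = u ^+ 4.
    transitivity ((W i a * (W i a)^*) * (W j b * (W j b)^*)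
      * (W i b * (W i b)^*) * (W j a * (W j a)^*)).
      by rewrite /z /z' /phase !rmorphM /=; ring.
    by rewrite !Wflat -/u; ring.
  have sqrE x y : phase (sqr_mx W) i j x y = phase W i j x y ^+ 2.
    by rewrite /phase !mxE !rmorphM /=; ring.
  rewrite DD !sqrE -/z -/z'.
  have -> : (2 * u ^+ 2 - (z + z')) ^+ 2 =
      4 * u ^+ 4 - 4 * u ^+ 2 * (z + z') + z ^+ 2 + z' ^+ 2 + 2 * (z * z').
    by ring.
  by rewrite zz; ring.
have sum_sym (X : 'M[C]_k) : \sum_i \sum_j \sum_a \sum_b
    (phase X i j a b + phase X i j b a) = 2 * \tr (gram X *m gram X).
  rewrite -sum_phase mulr_sumr; apply: eq_bigr => i _.
  rewrite mulr_sumr; apply: eq_bigr => j _.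
  rewrite mulr_natl mulr2n [X in _ = _ + X]exchange_big -big_split.
  by apply: eq_bigr => a _; rewrite -big_split.
have sum4D (f g : 'I_k -> 'I_k -> 'I_k -> 'I_k -> C) :
    \sum_i \sum_j \sum_a \sum_b (f i j a b + g i j a b) =
    \sum_i \sum_j \sum_a \sum_b f i j a b + \sum_i \sum_j \sum_a \sum_b g i j a b.
  by do 3![rewrite -big_split; apply: eq_bigr => ? _ /=]; rewrite -big_split.
have sum4M x (f : 'I_k -> 'I_k -> 'I_k -> 'I_k -> C) :
    \sum_i \sum_j \sum_a \sum_b (x * f i j a b) =
    x * \sum_i \sum_j \sum_a \sum_b f i j a b.
  by do 3![rewrite mulr_sumr; apply: eq_bigr => ? _ /=]; rewrite mulr_sumr.
rewrite (sum4D (fun i j a b => _ + _) (fun i j a b => _ + _)).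
rewrite (sum4D (fun i j a b => _) (fun i j a b => _ * _)).
rewrite (sum4M _ (fun i j a b => phase W i j a b + phase W i j b a)) !sum_sym.
(* Unitarity enters here: the sum of the [phase W] is the trace of 1. *)
have -> : gram W = 1%:M by [].
rewrite mulmx1 mxtrace1 -/(phase_energy W).
rewrite !sumr_const !card_ord -!mulrnA -[(_ - _) *+ _]mulr_natl !natrM /u.
by field.
Qed.

(** With [c] the inverse of the number of two-element subsets, the terms [c ^+ 2]
    add up to 1; the remaining terms are evaluated by [sum_minor]. *)
Lemma delta2_flat (R : realType) (k : nat) (W : 'M[R[i]]_k) :
    (1 < k)%N -> W \is unitarymx -> flat W ->
  (delta2 W)%:C = 1 / 2 - 2 / k%:R + phase_energy W / 2.
Proof.
move=> k1 Wunit Wflat.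
have k0 : (0 < k)%N by exact: ltnW.
have kC : k%:R != 0 :> R[i] by rewrite pnatr_eq0 -lt0n.
have kC1 : k%:R - 1 != 0 :> R[i] by rewrite subr_eq0 pnatr_eq1 gtn_eqF.
pose D i j a b := W i a * W j b - W i b * W j a.
pose c : R[i] := 'C(k, 2)%:R^-1.
have cE : c = 2 / (k%:R * (k%:R - 1)).
  have: 2 * 'C(k, 2)%:R = k%:R * (k%:R - 1) :> R[i].
    by rewrite -natrM -mul_bin_diag bin1 natrM -subn1 natrB.
  move=> E; rewrite -E invfM mulrA mulfV ?mul1r // pnatr_eq0 //.
have bin0 : 'C(k, 2)%:R != 0 :> R[i] by rewrite pnatr_eq0 -lt0n bin_gt0.
pose f i j a b := (D i j a b * (D i j a b)^*) ^+ 2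
  - 2 * c * (D i j a b * (D i j a b)^*).
have sumf := @sum_minor _ k W c k0 Wunit Wflat.
transitivity (1 + (\sum_i \sum_j \sum_a \sum_b f i j a b) / 4); last first.
  by rewrite sumf cE; field; rewrite kC kC1.
transitivity (\sum_(I : rsubset k 2) \sum_(J : rsubset k 2)
  (c ^+ 2 + f (rsubset_nth I 0) (rsubset_nth I 1)
              (rsubset_nth J 0) (rsubset_nth J 1))).
  rewrite /delta2 rmorph_sum; apply: eq_bigr => I _.
  rewrite rmorph_sum; apply: eq_bigr => J _.
  rewrite rmorphXn rmorphB /= normc_sqrE fmorphV rmorph_nat -/c det2E !mxE.
  by rewrite /f /D; ring.
have fsym i j a b : (f j i a b = f i j a b) * (f i j b a = f i j a b).
  have D1 : D j i a b = - D i j a b by rewrite /D; ring.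
  have D2 : D i j b a = - D i j a b by rewrite /D; ring.
  by rewrite /f D1 D2 rmorphN mulrNN.
have fdiag i a b : f i i a b = 0.
  have D0 : D i i a b = 0 by rewrite /D; ring.
  by rewrite /f D0 mul0r expr0n mulr0 subr0.
under eq_bigr do rewrite big_split /= sumr_const card_rsubset.
rewrite big_split /= sumr_const card_rsubset -!mulrnA -[c ^+ 2 *+ _]mulr_natr natrM.
congr (_ + _).
  by rewrite /c; field.
have -> : \sum_i \sum_j \sum_a \sum_b f i j a b =
    4 * \sum_(I : rsubset k 2) \sum_(J : rsubset k 2)
      f (rsubset_nth I 0) (rsubset_nth I 1) (rsubset_nth J 0) (rsubset_nth J 1).
  rewrite (sum_ordered_pairs (G := fun i j => \sum_a \sum_b f i j a b)).
  - rewrite -sumrMnl mulr_sumr; apply: eq_bigr => I _.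
    rewrite (sum_ordered_pairs (G := f _ _)); first by ring.
    + by move=> a b; exact: (fsym _ _ _ _).2.
    + move=> a; have D0 : D (rsubset_nth I 0) (rsubset_nth I 1) a a = 0.
        by rewrite /D; ring.
      by rewrite /f D0 mul0r expr0n mulr0 subr0.
  - move=> i j; apply: eq_bigr => a _; apply: eq_bigr => b _.
    exact: (fsym _ _ _ _).1.
  - by move=> i; rewrite big1 // => a _; rewrite big1.
by field.
Qed.

(** * Hadamard matrices and the Kronecker product *)

Lemma hadamard_flat (R : realType) (k : nat) (W : 'M[R[i]]_k) :
  complex_hadamard ((Num.sqrt (k%:R : R))%:C *: W) -> flat W.
Proof.
move=> [mod1 _] i a.
have k0 : (0 < k)%N by case: k i {a mod1 W} => // -[].
have kC : k%:R != 0 :> R[i] by rewrite pnatr_eq0 -lt0n.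
apply: (mulfI kC); rewrite mulfV // -normCK.
have := mod1 i a; rewrite mxE normrM => /(congr1 (fun z => z ^+ 2)).
rewrite expr1n exprMn => E; rewrite -[RHS]E; congr (_ * _).
rewrite normCK conj_Creal ?complex_real // -expr2 -rmorphXn sqr_sqrtr ?ler0n //.
by rewrite rmorph_nat.
Qed.

Theorem proposition5p8 (R : realType) (m n : nat)
    (hm : (4 <= m)%N) (hn : (4 <= n)%N)
    (U : 'M[R[i]]_m) (V : 'M[R[i]]_n)
    (hU : U \is unitarymx)
    (hUH : complex_hadamard ((Num.sqrt (m%:R : R))%:C *: U))
    (hV : V \is unitarymx)
    (hVH : complex_hadamard ((Num.sqrt (n%:R : R))%:C *: V)) :
  delta2 (U *t V) =
    (m%:R * n%:R - 3) / (2 * m%:R * n%:R)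
    + 2 * (delta2 U - (m%:R - 3) / (2 * m%:R))
        * (delta2 V - (n%:R - 3) / (2 * n%:R))
    + n%:R^-1 * (delta2 U - (m%:R - 3) / (2 * m%:R))
    + m%:R^-1 * (delta2 V - (n%:R - 3) / (2 * n%:R)) :> R.
Proof.
have m1 : (1 < m)%N by apply: leq_trans hm.
have n1 : (1 < n)%N by apply: leq_trans hn.
have mC : m%:R != 0 :> R[i] by rewrite pnatr_eq0 -lt0n ltnW.
have nC : n%:R != 0 :> R[i] by rewrite pnatr_eq0 -lt0n ltnW.
have fU := hadamard_flat hUH; have fV := hadamard_flat hVH.
have fUV : flat (U *t V).
  by move=> i a; rewrite mxE rmorphM mulrACA fU fV natrM invfM.
have uUV : U *t V \is unitarymx.
  apply/unitarymxP; rewrite trmx_tens map_mxT tensmx_mul.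
  rewrite (unitarymxP hU) (unitarymxP hV).
  apply/matrixP => i j; rewrite !mxE -natrM mulnb -xpair_eqE -!surjective_pairing.
  by rewrite (can_eq (@mxtens_unindexK m n)).
have mn1 : (1 < m * n)%N by rewrite (leq_trans m1) // leq_pmulr // ltnW.
(* The invariant [phase_energy] is complex-valued, so the comparison takes
   place in [R[i]]. *)
apply: (fmorph_inj (real_complex R)).
rewrite !(rmorphD, rmorphB, rmorphM, fmorphV, rmorph_nat) /=.
rewrite (delta2_flat mn1 uUV fUV) phase_energy_tens natrM.
rewrite (delta2_flat m1 hU fU) (delta2_flat n1 hV fV).
by field; rewrite mC nC.
Qed.
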